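(* A 3-dimensional complex transposed Poisson algebra admits a Novikov--Poisson realization if and only if it is not isomorphic to $\mathbf{P19}$, where $\mathbf{P19}$ is the transposed Poisson algebra with zero commutative product and underlying Lie algebra $\mathfrak{sl}_2(\mathbb C)$.
   Context: All algebras are over $\mathbb C$. A transposed Poisson algebra is a triple $(A,\cdot,[\,,])$ where $(A,\cdot)$ is a commutative associative algebra (not necessarily unital, possibly with zero product), $(A,[\,,])$ is a Lie algebra, and $2z\cdot[x,y]=[z\cdot x,y]+[x,z\cdot y]$ for all $x,y,z\in A$. Isomorphisms are linear bijections preserving both operations. A Novikov algebra is a vector space with a bilinear product $\circ$ such that $(x\circ y)\circ z-x\circ(y\circ z)=(y\circ x)\circ z-y\circ(x\circ z)$ and $(x\circ y)\circ z=(x\circ z)\circ y$ for all $x,y,z$. A Novikov--Poisson algebra is a triple $(A,\cdot,\circ)$ where $(A,\cdot)$ is commutative associative, $(A,\circ)$ is Novikov, and $(x\cdot y)\circ z=x\cdot(y\circ z)$, $(x\circ y)\cdot z-(y\circ x)\cdot z=x\circ(y\cdot z)-y\circ(x\cdot z)$ for all $x,y,z$. A transposed Poisson algebra $(A,\cdot,[\,,])$ admits a Novikov--Poisson realization (is ''special'' as a transposed Poisson algebra) if there is a bilinear product $\circ$ on $A$ such that $(A,\cdot,\circ)$ is a Novikov--Poisson algebra and $[x,y]=x\circ y-y\circ x$ for all $x,y\in A$. *)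

(* Defs.v *)
From HB Require Import structures.
From mathcomp Require Import all_boot all_order all_algebra.
From mathcomp Require Import ring.

Set Implicit Arguments.
Unset Strict Implicit.
Unset Printing Implicit Defensive.

Import GRing.Theory.
Local Open Scope ring_scope.

Section Identities.
Variables (K : fieldType) (V : vectType K).
Implicit Types mul br circ : V -> V -> V.

Definition is_comm_assoc mul : Prop :=
  commutative mul /\ associative mul.

Definition is_lie br : Prop :=
  (forall x, br x x = 0) /\
  (forall x y z, br x (br y z) + br y (br z x) + br z (br x y) = 0).

Definition is_transposed_leibniz mul br : Prop :=
  forall x y z, mul z (br x y) *+ 2 = br (mul z x) y + br x (mul z y).

Definition is_novikov circ : Prop :=
  (forall x y z, circ (circ x y) z - circ x (circ y z)
               = circ (circ y x) z - circ y (circ x z)) /\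
  (forall x y z, circ (circ x y) z = circ (circ x z) y).

Definition is_novikov_poisson mul circ : Prop :=
  [/\ is_comm_assoc mul,
      is_novikov circ,
      forall x y z, circ (mul x y) z = mul x (circ y z)
    & forall x y z, mul (circ x y) z - mul (circ y x) z
                  = circ x (mul y z) - circ y (mul x z)].

End Identities.

Record tpAlgebra (K : fieldType) := TPAlgebra {
  tp_sort :> vectType K;
  tp_mul : {bilinear tp_sort -> tp_sort -> tp_sort};
  tp_br : {bilinear tp_sort -> tp_sort -> tp_sort};
  tp_mulP : is_comm_assoc tp_mul;
  tp_brP : is_lie tp_br;
  tp_leibnizP : is_transposed_leibniz tp_mul tp_br
}.

Definition tp_isomorphic (K : fieldType) (A B : tpAlgebra K) : Prop :=
  exists f : {linear A -> B},
    [/\ bijective f,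
        forall x y, f (tp_mul A x y) = tp_mul B (f x) (f y)
      & forall x y, f (tp_br A x y) = tp_br B (f x) (f y)].

Definition has_novikov_poisson_realization (K : fieldType) (A : tpAlgebra K)
    : Prop :=
  exists circ : {bilinear A -> A -> A},
    is_novikov_poisson (tp_mul A) circ /\
    (forall x y, tp_br A x y = circ x y - circ y x).

Section P19.
Variable K : fieldType.

Definition sl2 : {vspace 'M[K]_2} :=
  lker (linfun (mxtrace : 'M[K]_2 -> K^o)).

Lemma mem_sl2 (M : 'M[K]_2) : (M \in sl2) = (\tr M == 0).
Proof. by rewrite memv_ker lfunE. Qed.

Definition sl2_mul (x y : subvs_of sl2) : subvs_of sl2 := 0.

(* The commutator is already traceless, so vsproj only retypes it: see
   val_sl2_br. *)
Definition sl2_br (x y : subvs_of sl2) : subvs_of sl2 :=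
  vsproj sl2 (vsval x *m vsval y - vsval y *m vsval x).

Lemma val_sl2_br x y :
  vsval (sl2_br x y) = vsval x *m vsval y - vsval y *m vsval x.
Proof.
by rewrite vsprojK // mem_sl2 linearB /= mxtrace_mulC subrr.
Qed.

Lemma sl2_mul_bilinear : bilinear_for *:%R *:%R sl2_mul.
Proof.
by split=> u a v w; rewrite /sl2_mul /= scaler0 addr0.
Qed.

HB.instance Definition _ :=
  bilinear_isBilinear.Build K (subvs_of sl2) (subvs_of sl2) (subvs_of sl2)
    *:%R *:%R sl2_mul sl2_mul_bilinear.

Lemma sl2_br_bilinear : bilinear_for *:%R *:%R sl2_br.
Proof.
have valP2 a (v w : subvs_of sl2) :
    vsval (a *: v + w) = a *: vsval v + vsval w by [].
by split=> u a v w; apply: val_inj;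
  rewrite /= [LHS]val_sl2_br !valP2 !val_sl2_br
    mulmxDl mulmxDr -scalemxAl -scalemxAr scalerBr opprD addrACA.
Qed.

HB.instance Definition _ :=
  bilinear_isBilinear.Build K (subvs_of sl2) (subvs_of sl2) (subvs_of sl2)
    *:%R *:%R sl2_br sl2_br_bilinear.

Lemma sl2_mulP : is_comm_assoc sl2_mul.
Proof. by []. Qed.

Lemma sl2_brP : is_lie sl2_br.
Proof.
split=> [x|x y z]; apply: val_inj; first by rewrite /= val_sl2_br subrr.
transitivity (vsval (sl2_br x (sl2_br y z)) + vsval (sl2_br y (sl2_br z x))
              + vsval (sl2_br z (sl2_br x y))); first by [].
rewrite !val_sl2_br !mulmxBr !mulmxBl !mulmxA [RHS]/=.
do ![move: (_ *m _ *m _) => ?].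
apply/matrixP=> i j; rewrite !mxE.
ring.
Qed.

Lemma sl2_leibnizP : is_transposed_leibniz sl2_mul sl2_br.
Proof.
move=> x y z; apply: val_inj.
by rewrite /sl2_mul mul0rn linear0l linear0r addr0.
Qed.

Definition P19 : tpAlgebra K :=
  TPAlgebra sl2_mulP sl2_brP sl2_leibnizP.

End P19.

(* Main.v *)
(** Write L_z, R_z for left and right multiplications and A_0 = {x | e x = 0}.

    On sl_2 a Novikov product x o y would satisfy
    R_{x o y} = [L_x, R_y] + R_y R_x.  As sl_2 is perfect, every L_x and every
    ad_x = L_x - R_x is traceless, so tr R_x = 0, and taking traces in this
    relation gives tr (R_y R_x) = 0 and tr (R_x ^ 3) = 0.  In dimension 3 each R_x
    is thus nilpotent; they commute, so some v <> 0 has L_v = 0.  The kernel of L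
    is an ideal of sl_2, hence L = 0 and the bracket vanishes.

    Conversely, a nonzero idempotent e splits A into the ideals e A and A_0.  If
    the bracket vanishes on A_0, then x o y = x [e, y] works; otherwise the Leibniz
    rule forces the products in the plane A_0 to be nilpotent, unless A is unital.
    If there is no idempotent, every x satisfies x^4 = 0, and A has a basis
    x, x^2, x^3, or satisfies x y = B(x, y) c with c annihilating A, or has zero
    product.  In the last case a plane subalgebra (an eigenvector of ad x on
    A / <x>) shows that the Lie algebra A is sl_2 or has an abelian ideal of
    codimension 1, and then x o y = tau(x) [t, y] works for a linear form tau
    with kernel that ideal and tau(t) = 1. *)

Require Import Defs.
From HB Require Import structures.
From mathcomp Require Import all_boot all_order all_algebra.
From mathcomp Require Import reals complex.
From mathcomp Require Import ring boolp.

Set Implicit Arguments.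
Unset Strict Implicit.
Unset Printing Implicit Defensive.

Import Order.TTheory GRing.Theory Num.Theory.
Local Open Scope ring_scope.

Local Notation "x ** y" := (tp_mul _ x y) (at level 40, left associativity).
Local Notation "[< x , y >]" := (tp_br _ x y) (at level 0).

(** * Coordinates in dimension 3 *)

Lemma scaler_eq0_vector (K : fieldType) (V : lmodType K) (k : K) (v : V) :
  k != 0 -> k *: v = 0 -> v = 0.
Proof. by move=> k0 /eqP; rewrite scaler_eq0 (negPf k0) => /eqP. Qed.

Lemma scaler_eq0_scalar (K : fieldType) (V : lmodType K) (k : K) (v : V) :
  v != 0 -> k *: v = 0 -> k = 0.
Proof. by move=> v0 /eqP; rewrite scaler_eq0 (negPf v0) orbF => /eqP. Qed.

Lemma mulr2I (K : numFieldType) (V : lmodType K) : injective (fun u : V => u *+ 2).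
Proof.
move=> u v; rewrite -!scaler_nat => /eqP.
by rewrite -subr_eq0 -scalerBr scaler_eq0 pnatr_eq0 subr_eq0 => /eqP.
Qed.

Section Frames.
Variables (K : fieldType) (V : vectType K).
Implicit Types (e : V) (p q r : {scalar V}).

(** The coordinate forms are kept together with the basis, so that an identity between vectors
    becomes three scalar identities within reach of [ring]. *)
Record frame e1 e2 e3 p q r : Prop := Frame {
  frameE : forall x, x = p x *: e1 + q x *: e2 + r x *: e3;
  frame1 : [/\ p e1 = 1, q e1 = 0 & r e1 = 0];
  frame2 : [/\ p e2 = 0, q e2 = 1 & r e2 = 0];
  frame3 : [/\ p e3 = 0, q e3 = 0 & r e3 = 1]
}.

Lemma free_frame e1 e2 e3 : \dim {:V} = 3%N -> free [:: e1; e2; e3] ->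
  exists p q r, frame e1 e2 e3 p q r.
Proof.
move=> dimV freeX; pose X := [tuple e1; e2; e3].
have basX : basis_of fullv X by rewrite basisEfree freeX subvf dimV.
pose c i : {scalar V} := coord X i.
pose i1 : 'I_3 := lift ord0 ord0; pose i2 : 'I_3 := lift ord0 (lift ord0 ord0).
have cX (i j : 'I_3) : c i X`_j = (j == i)%:R by apply: coord_free.
exists (c ord0), (c i1), (c i2); split.
- move=> x; rewrite {1}(coord_basis basX (memvf x)) !big_ord_recl big_ord0 addr0.
  by rewrite addrA.
- by split; rewrite (cX _ ord0).
- by split; rewrite (cX _ i1).
- by split; rewrite (cX _ i2).
Qed.

Lemma free3P e1 e2 e3 :
  (forall a b c : K, a *: e1 + b *: e2 + c *: e3 = 0 -> [/\ a = 0, b = 0 & c = 0]) ->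
  free [:: e1; e2; e3].
Proof.
move=> H; apply/(freeP (X := [tuple e1; e2; e3])) => k.
rewrite !big_ord_recl big_ord0 addr0 addrA /= => /H[k0 k1 k2] [[|[|[|//]]] Hi].
- by rewrite -k0; congr k; apply: val_inj.
- by rewrite -k1; congr k; apply: val_inj.
- by rewrite -k2; congr k; apply: val_inj.
Qed.

Lemma free2P e1 e2 :
  (forall a b : K, a *: e1 + b *: e2 = 0 -> a = 0 /\ b = 0) -> free [:: e1; e2].
Proof.
move=> H; apply/(freeP (X := [tuple e1; e2])) => k.
rewrite !big_ord_recl big_ord0 addr0 /= => /H[k0 k1] [[|[|//]] Hi].
- by rewrite -k0; congr k; apply: val_inj.
- by rewrite -k1; congr k; apply: val_inj.
Qed.

Lemma free_extend3 e1 e2 : \dim {:V} = 3%N -> free [:: e1; e2] ->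
  exists e3, free [:: e1; e2; e3].
Proof.
move=> dimV free2.
have [full|nfull] := eqVneq (<<[:: e1; e2]>>%VS) fullv.
  by have := free2; rewrite /free full dimV.
 have : ~~ (fullv <= <<[:: e1; e2]>>)%VS.
  by apply: contra nfull; rewrite eqEsubv subvf.
case/subvPn=> e3 _ e3N; exists e3; rewrite -[[:: e1; e2; e3]]/(rcons [:: e1; e2] e3).
by rewrite (perm_free (permEl (perm_rcons e3 [:: e1; e2]))) free_cons e3N.
Qed.

Lemma free_extend2 e1 : \dim {:V} = 3%N -> e1 != 0 ->
  exists e2 e3, free [:: e1; e2; e3].
Proof.
move=> dimV e10.
have free1 : free [:: e1] by rewrite seq1_free.
have : ~~ (fullv <= <<[:: e1]>>)%VS.
  apply/negP => full; have /eqP : <<[:: e1]>>%VS == fullv by rewrite eqEsubv subvf.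
  by move=> full1; have := free1; rewrite /free full1 dimV.
case/subvPn=> e2 _ e2N.
have free2 : free (rcons [:: e1] e2).
  by rewrite (perm_free (permEl (perm_rcons e2 [:: e1]))) free_cons e2N.
by have [e3 ?] := free_extend3 dimV free2; exists e2, e3.
Qed.

Lemma frame_coef e1 e2 e3 p q r a b c : frame e1 e2 e3 p q r ->
  let x := a *: e1 + b *: e2 + c *: e3 in [/\ p x = a, q x = b & r x = c].
Proof.
case=> _ [p1 q1 r1] [p2 q2 r2] [p3 q3 r3] /=.
by rewrite !linearD !linearZ /= p1 q1 r1 p2 q2 r2 p3 q3 r3; split; ring.
Qed.

Lemma frame_inj e1 e2 e3 p q r x y : frame e1 e2 e3 p q r ->
  p x = p y -> q x = q y -> r x = r y -> x = y.
Proof. by case=> E _ _ _ px qx rx; rewrite (E x) (E y) px qx rx. Qed.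

(** One bundle of rewriting rules for all forms; scaling becomes a product in [K], as [ring]
    expects. *)
Lemma scalarE (l : {scalar V}) :
  (forall x y, (l (x + y) = l x + l y)%R) * (forall x, (l (- x) = - l x)%R) *
  (forall k x, (l (k *: x) = k * l x)%R) * (l 0 = 0).
Proof. by do !split=> *; rewrite ?linearD ?linearZ ?linearN ?linear0. Qed.

(** Serves for both the product and the bracket: it reduces them to their values on the nine pairs
    of basis vectors. *)
Lemma frame_bilinear e1 e2 e3 p q r (B : {bilinear V -> V -> V}) (l : {scalar V}) x y :
  frame e1 e2 e3 p q r ->
  l (B x y) = p x * (p y * l (B e1 e1) + q y * l (B e1 e2) + r y * l (B e1 e3))
            + q x * (p y * l (B e2 e1) + q y * l (B e2 e2) + r y * l (B e2 e3))
            + r x * (p y * l (B e3 e1) + q y * l (B e3 e2) + r y * l (B e3 e3)).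
Proof.
case=> E _ _ _.
have El z : l (B x z) = p x * l (B e1 z) + q x * l (B e2 z) + r x * l (B e3 z).
  by rewrite {1}(E x) !linearDl !linearZl_LR !linearD !linearZ.
have Er z : l (B z y) = p y * l (B z e1) + q y * l (B z e2) + r y * l (B z e3).
  by rewrite {1}(E y) linearDr linearDr !linearZr_LR !linearD !linearZ.
by rewrite El !Er; ring.
Qed.

End Frames.

(** * Constructing Novikov--Poisson realizations *)

Section TransposedPoisson.
Variables (K : numFieldType) (A : tpAlgebra K).
Implicit Types x y z : A.

Lemma tp_mulC x y : x ** y = y ** x. Proof. exact: (tp_mulP A).1. Qed.
Lemma tp_mulA x y z : x ** (y ** z) = x ** y ** z. Proof. exact: (tp_mulP A).2. Qed.
Lemma tp_mulAC x y z : x ** y ** z = x ** z ** y.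
Proof. by rewrite -tp_mulA (tp_mulC y) tp_mulA. Qed.
Lemma tp_mulCA x y z : x ** (y ** z) = y ** (x ** z).
Proof. by rewrite tp_mulA (tp_mulC x) -tp_mulA. Qed.
Lemma tp_brxx x : [<x, x>] = 0. Proof. exact: (tp_brP A).1. Qed.
Lemma tp_brC x y : [<x, y>] = - [<y, x>].
Proof.
have := tp_brxx (x + y); rewrite linearDl !linearDr !tp_brxx add0r addr0.
by move/eqP; rewrite addr_eq0 => /eqP.
Qed.
Lemma tp_leibniz z x y : (z ** [<x, y>]) *+ 2 = [<z ** x, y>] + [<x, z ** y>].
Proof. exact: tp_leibnizP. Qed.

Lemma realization_of (circ : A -> A -> A) :
  bilinear_for *:%R *:%R circ -> is_novikov_poisson (tp_mul A) circ ->
  (forall x y, [<x, y>] = circ x y - circ y x) ->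
  has_novikov_poisson_realization A.
Proof.
move=> bil np brE.
pose bilM := bilinear_isBilinear.Build K A A A *:%R *:%R circ bil.
pose F : {bilinear A -> A -> A} := HB.pack circ bilM.
by exists F.
Qed.

(** The Gelfand--Dorfman product x D(y) is used. Its associator is - x y D(D(z)), which is symmetric
    in x and y. *)
Lemma realization_deriv (D : {linear A -> A}) :
  (forall x y, D (x ** y) = x ** D y + y ** D x) ->
  (forall x y, [<x, y>] = x ** D y - y ** D x) ->
  has_novikov_poisson_realization A.
Proof.
move=> DM brE; apply: (@realization_of (fun x y => x ** D y)) => //.
- by split=> u a x y; rewrite ?linearP ?linearPl // linearP linearP.
- split.
  + by split; [exact: tp_mulC | exact: tp_mulA].
  + split=> x y z; last by rewrite tp_mulAC.
    have assoc u v w : u ** D v ** D w - u ** D (v ** D w) = - (u ** v ** D (D w)).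
      by rewrite DM linearDr !tp_mulA (tp_mulAC u (D w)) opprD addrCA subrr addr0.
    by rewrite !assoc (tp_mulC x).
  + by move=> x y z; rewrite tp_mulA.
  + move=> x y z; rewrite !DM !linearDr !tp_mulA (tp_mulC y x) (tp_mulAC y z).
    by rewrite opprD addrACA subrr add0r (tp_mulAC x z).
Qed.

(** The Leibniz rule for e gives e [x, y] = [x, y] / 2, and 1/2 is not an eigenvalue of
    multiplication by an idempotent. *)
Lemma br_idempotent e x y : e ** e = e -> e ** x = x -> e ** y = 0 -> [<x, y>] = 0.
Proof.
move=> ee ex ey.
have L : (e ** [<x, y>]) *+ 2 = [<x, y>] by rewrite tp_leibniz ex ey linear0r addr0.
have : e ** ((e ** [<x, y>]) *+ 2) = e ** [<x, y>] by rewrite L.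
rewrite linearMnr /= tp_mulA ee mulr2n -[RHS]addr0 => /addrI L0.
by rewrite -L L0 mul0rn.
Qed.

(** The bracket lives on e A. With D = ad e, the Leibniz rule reads 2 x D(y) = [x, y] + D(x y): its
    symmetric part makes D a derivation, its antisymmetric part gives the bracket as x D(y) - y
    D(x). *)
Lemma realization_idempotent e : e ** e = e ->
  (forall x y, e ** x = 0 -> e ** y = 0 -> [<x, y>] = 0) ->
  has_novikov_poisson_realization A.
Proof.
move=> ee br0.
pose P x := e ** x; pose Q x := x - P x.
have PQ x : x = P x + Q x by rewrite addrC subrK.
have eP x : e ** P x = P x by rewrite /P tp_mulA ee.
have eQ x : e ** Q x = 0 by rewrite /Q linearBr /= eP subrr.
clearbody Q.
have brPQ x y : [<P x, Q y>] = 0 by apply: (br_idempotent ee).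
have brP x y : [<x, y>] = [<P x, P y>].
  rewrite {1}(PQ x) {1}(PQ y) linearDl !linearDr brPQ addr0.
  by rewrite (tp_brC (Q x)) brPQ oppr0 add0r (br0 (Q x)) ?eQ // addr0.
pose D : {linear A -> A} := tp_br A e.
have L x y : (x ** D y) *+ 2 = [<x, y>] + D (x ** y).
  rewrite /D tp_leibniz; congr (_ + _).
  by rewrite brP [RHS]brP; congr (tp_br _ _ _); rewrite /P tp_mulCA ee tp_mulC.
have DM x y : D (x ** y) = x ** D y + y ** D x.
  apply: (@mulr2I _ A); rewrite mulrnDl !L (tp_mulC y) (tp_brC y).
  by rewrite addrACA subrr add0r.
apply: (realization_deriv DM) => x y; apply: (addIr (D (x ** y))).
by rewrite -L DM [x ** D y + y ** D x]addrC addrA subrK mulr2n.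
Qed.

(* The last Novikov--Poisson axiom here is the Leibniz rule, rewritten with the
   formula for the bracket. *)
Lemma realization_abelian (tau : {scalar A}) t :
  (forall x y, [<x, y>] = tau x *: [<t, y>] - tau y *: [<t, x>]) ->
  (forall y, tau [<t, y>] = 0) ->
  (forall x y z, x ** [<y, z>] = 0) ->
  (forall x y, tau (x ** y) = 0) ->
  has_novikov_poisson_realization A.
Proof.
move=> brE tau_br mul_br tau_mul.
apply: (@realization_of (fun x y => tau x *: [<t, y>])) => //.
- split=> u a x y.
    by rewrite !linearP /= scalerDl scalerA.
  by rewrite linearPr /= scalerDr !scalerA mulrC.
- split.
  + by split; [exact: tp_mulC | exact: tp_mulA].
  + split=> x y z; rewrite ![tau (_ *: _)]linearZ /= !tau_br !mulr0 !scale0r //.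
    by rewrite !linearZr_LR /= !sub0r !scalerA mulrC.
  + by move=> x y z; rewrite tau_mul scale0r linearZr_LR /= mul_br scaler0.
  + move=> x y z; rewrite ![(_ *: _) ** _]tp_mulC !linearZr_LR /= !mul_br !scaler0 subrr.
    have := tp_leibniz z x y; rewrite mul_br mul0rn (brE (z ** x)) (brE x) !tau_mul.
    by rewrite !scale0r sub0r subr0 addrC (tp_mulC x) (tp_mulC y).
Qed.

End TransposedPoisson.

(** * Realizations by explicit products in coordinates *)

Section CoordinateRealizations.
Variables (K : numFieldType) (A : tpAlgebra K).
Implicit Types x y z : A.

(** Modulo [e3] the bracket is rho(y) x - rho(x) y, so right multiplication by y is taken to be the
    scalar rho(y) there. The [e3] term of [circ] then corrects the last coordinate of the
    bracket. *)
Lemma realization_conformal (e1 e2 e3 : A) p q r a b g m :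
  frame e1 e2 e3 p q r ->
  e1 ** e1 = e3 -> e1 ** e2 = 0 -> e2 ** e2 = g *: e3 ->
  (forall x, x ** e3 = 0) ->
  [<e1, e2>] = m *: e1 + b *: e2 + a *: e3 ->
  [<e1, e3>] = (2 * b) *: e3 -> [<e2, e3>] = - (2 * m) *: e3 ->
  has_novikov_poisson_realization A.
Proof.
move=> F m11 m12 m22 mc b12 b13 b23.
have [E [p1 q1 r1] [p2 q2 r2] [p3 q3 r3]] := F.
have m21 : e2 ** e1 = 0 by rewrite tp_mulC.
have mc' x : e3 ** x = 0 by rewrite tp_mulC.
pose rho x := m * q x - b * p x.
pose circ x y := rho y *: x + (a * p x * q y - rho x * r y) *: e3.
have mE x y : x ** y = (p x * p y + g * q x * q y) *: e3.
  by apply: (frame_inj F); rewrite (frame_bilinear _ _ _ _ F) m11 m12 m21 m22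
    !mc !mc' !scalarE ?p3 ?q3 ?r3; ring.
have bE : [/\ forall x y, p [<x, y>] = rho y * p x - rho x * p y,
   forall x y, q [<x, y>] = rho y * q x - rho x * q y &
   forall x y, r [<x, y>] = a * (p x * q y - p y * q x) + 2 * (rho y * r x - rho x * r y)].
  by split=> x y; rewrite (frame_bilinear _ _ _ _ F) !tp_brxx (tp_brC e2 e1) (tp_brC e3 e1)
    (tp_brC e3 e2) b12 b13 b23 !scalarE
    ?(p1, p2, p3, q1, q2, q3, r1, r2, r3) /rho; ring.
have [bp bq br] := bE.
have cp x y : p (circ x y) = rho y * p x.
  by rewrite /circ !scalarE p3; ring.
have cq x y : q (circ x y) = rho y * q x.
  by rewrite /circ !scalarE q3; ring.
have cr x y : r (circ x y) = rho y * r x + (a * p x * q y - rho x * r y).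
  by rewrite /circ !scalarE r3; ring.
have mp x y : p (x ** y) = 0 by rewrite mE scalarE p3 mulr0.
have mq x y : q (x ** y) = 0 by rewrite mE scalarE q3 mulr0.
have mr x y : r (x ** y) = p x * p y + g * q x * q y by rewrite mE scalarE r3 mulr1.
pose cE := (cp, cq, cr, (mp, mq, mr), (bp, bq, br)).
(* From here on only the coordinate formulas in [cE] matter: every axiom is a polynomial identity in
   the coordinates of x, y and z. *)
clearbody circ; clear E mE bE b12 b13 b23 m11 m12 m22 m21 mc mc' p1 p2 p3 q1 q2 q3 r1 r2 r3.
apply: (@realization_of _ _ circ).
- by split=> u k x y; apply: (frame_inj F); rewrite !(cE, scalarE) /rho ?scalarE; ring.
- split.
  + by split; [exact: tp_mulC | exact: tp_mulA].
  + by split=> x y z; apply: (frame_inj F); rewrite !(cE, scalarE) /rho ?cE /rho; ring.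
  + by move=> x y z; apply: (frame_inj F); rewrite !(cE, scalarE) /rho ?cE /rho; ring.
  + by move=> x y z; apply: (frame_inj F); rewrite !(cE, scalarE) /rho ?cE /rho; ring.
- by move=> x y; apply: (frame_inj F); rewrite !(cE, scalarE); ring.
Qed.

(** With [e1], [e2], [e3] read as T, T^2, T^3 in T K[T] / (T^4), [circ] is the product f g' (a + b
    T), where g' is the derivative of g; it sends (T^i, T^j) to j (a T^(i+j-1) + b T^(i+j)). *)
Lemma realization_nilpotent_chain (e1 e2 e3 : A) p q r a b :
  frame e1 e2 e3 p q r ->
  e1 ** e1 = e2 -> e1 ** e2 = e3 -> e2 ** e2 = 0 -> (forall x, x ** e3 = 0) ->
  [<e1, e2>] = a *: e2 + b *: e3 -> [<e1, e3>] = (2 * a) *: e3 ->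
  [<e2, e3>] = 0 ->
  has_novikov_poisson_realization A.
Proof.
move=> F m11 m12 m22 mc b12 b13 b23.
have [E [p1 q1 r1] [p2 q2 r2] [p3 q3 r3]] := F.
have m21 : e2 ** e1 = e3 by rewrite tp_mulC.
have mc' x : e3 ** x = 0 by rewrite tp_mulC.
pose circ x y := (a * p x * p y) *: e1 +
  (b * p x * p y + 2 * a * p x * q y + a * q x * p y) *: e2 +
  (2 * b * p x * q y + 3 * a * p x * r y + b * q x * p y
   + 2 * a * q x * q y + a * r x * p y) *: e3.
pose basE := (p1, p2, p3, q1, q2, q3, (r1, r2, r3)).
have mE x y : x ** y = (p x * p y) *: e2 + (p x * q y + q x * p y) *: e3.
  by apply: (frame_inj F); rewrite (frame_bilinear _ _ _ _ F) m11 m12 m21 m22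
    !mc !mc' !scalarE ?basE; ring.
have bE x y : [<x, y>] = (a * (p x * q y - q x * p y)) *: e2
   + (b * (p x * q y - q x * p y) + 2 * a * (p x * r y - r x * p y)) *: e3.
  by apply: (frame_inj F); rewrite (frame_bilinear _ _ _ _ F) !tp_brxx
    (tp_brC e2 e1) (tp_brC e3 e1) (tp_brC e3 e2) b12 b13 b23 !scalarE ?basE; ring.
have cp x y : p (circ x y) = a * p x * p y.
  by rewrite /circ !(scalarE, basE); ring.
have cq x y : q (circ x y) = b * p x * p y + 2 * a * p x * q y + a * q x * p y.
  by rewrite /circ !(scalarE, basE); ring.
have cr x y : r (circ x y) = 2 * b * p x * q y + 3 * a * p x * r y
    + b * q x * p y + 2 * a * q x * q y + a * r x * p y.
  by rewrite /circ !(scalarE, basE); ring.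
have mp x y : p (x ** y) = 0 by rewrite mE !(scalarE, basE); ring.
have mq x y : q (x ** y) = p x * p y by rewrite mE !(scalarE, basE); ring.
have mr x y : r (x ** y) = p x * q y + q x * p y by rewrite mE !(scalarE, basE); ring.
have bp x y : p [<x, y>] = 0 by rewrite bE !(scalarE, basE); ring.
have bq x y : q [<x, y>] = a * (p x * q y - q x * p y).
  by rewrite bE !(scalarE, basE); ring.
have br x y : r [<x, y>] = b * (p x * q y - q x * p y) + 2 * a * (p x * r y - r x * p y).
  by rewrite bE !(scalarE, basE); ring.
pose cE := (cp, cq, cr, (mp, mq, mr), (bp, bq, br)).
clearbody circ; clear E mE bE b12 b13 b23 m11 m12 m22 m21 mc mc' basE p1 p2 p3 q1 q2 q3 r1 r2 r3.
apply: (@realization_of _ _ circ).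
- by split=> u k x y; apply: (frame_inj F); rewrite !(cE, scalarE); ring.
- split.
  + by split; [exact: tp_mulC | exact: tp_mulA].
  + by split=> x y z; apply: (frame_inj F); rewrite !(cE, scalarE); ring.
  + by move=> x y z; apply: (frame_inj F); rewrite !(cE, scalarE); ring.
  + by move=> x y z; apply: (frame_inj F); rewrite !(cE, scalarE); ring.
- by move=> x y; apply: (frame_inj F); rewrite !(cE, scalarE); ring.
Qed.

End CoordinateRealizations.

(** * Three-dimensional Lie algebras *)

(** Cramer's rule: the left-hand side is the determinant of the coordinates, and the multipliers
    given to [Z] are cofactors. The separate [d] lets callers state the determinant in simplified
    form. *)
Lemma frame_free3 (K : fieldType) (d : K) (V : vectType K) (e1 e2 e3 x y z : V) p q r :
  frame e1 e2 e3 p q r ->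
  p x * (q y * r z - r y * q z) - q x * (p y * r z - r y * p z)
    + r x * (p y * q z - q y * p z) = d ->
  d != 0 -> free [:: x; y; z].
Proof.
move=> F dE d0; apply: free3P => a b c abc0.
have E (l : {scalar V}) : a * l x + b * l y + c * l z = 0.
  by rewrite -!scalarE abc0 scalarE.
have Z u (k1 k2 k3 : K) :
    u * d = k1 * (a * p x + b * p y + c * p z) + k2 * (a * q x + b * q y + c * q z)
            + k3 * (a * r x + b * r y + c * r z) -> u = 0.
  move=> /eqP; rewrite E E E !mulr0 !addr0 mulf_eq0 (negPf d0) orbF.
  by move/eqP.
split.
- apply: (Z a (q y * r z - r y * q z) (r y * p z - p y * r z) (p y * q z - q y * p z)).
  by rewrite -dE; ring.
- apply: (Z b (r x * q z - q x * r z) (p x * r z - r x * p z) (q x * p z - p x * q z)).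
  by rewrite -dE; ring.
- apply: (Z c (q x * r y - r x * q y) (r x * p y - p x * r y) (p x * q y - q x * p y)).
  by rewrite -dE; ring.
Qed.

Section Lie3.
Variables (K : numClosedFieldType) (A : tpAlgebra K).
Hypothesis dimA : \dim {:A} = 3%N.
Implicit Types x y z : A.

Lemma tp_jacobi x y z :
  [<x, [<y, z>]>] + [<y, [<z, x>]>] + [<z, [<x, y>]>] = 0.
Proof. exact: (tp_brP A).2. Qed.

(* y lifts an eigenvector of ad x on A / <x>. *)
Lemma subalgebra_dim2 : exists x y t : A, free [:: x; y; t] /\
  exists k l, [<x, y>] = k *: x + l *: y.
Proof.
have [x x0] : exists x : A, x != 0.
  have [/eqP|n0] := eqVneq (vpick {:A}) 0; last by exists (vpick {:A}).
  by rewrite vpick0 => /eqP f0; have := dimA; rewrite f0 dimv0.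
have [y [t xyt]] := free_extend2 dimA x0.
have [p [q [r F]]] := free_frame dimA xyt.
have [E [p1 q1 r1] [p2 q2 r2] [p3 q3 r3]] := F.
pose basE := (p1, p2, p3, q1, q2, q3, (r1, r2, r3)).
pose a := q [<x, y>]; pose b := r [<x, y>].
pose c := q [<x, t>]; pose d := r [<x, t>].
have [b0|b0] := eqVneq b 0.
  exists x, y, t; split=> //; exists (p [<x, y>]), a.
  by rewrite {1}(E [<x, y>]) -/a -/b b0 scale0r addr0.
(* The scalar [s] is a root of b s^2 + (d - a) s - c, the condition for [s *: y + t] to be an
   eigenvector of ad x modulo x, with eigenvalue s b + d. *)
pose D := sqrtC ((a - d) ^+ 2 + 4 * b * c).
pose s := ((a - d) + D) / (2 * b).
have sE : s * a + c = s * (s * b + d).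
  have DE : D ^+ 2 = (a - d) ^+ 2 + 4 * b * c by rewrite sqrtCK.
  have -> : c = (D ^+ 2 - (a - d) ^+ 2) / (4 * b) by rewrite DE; field.
  by rewrite /s; field.
exists x, (s *: y + t), y; split.
  apply: (frame_free3 (d := -1) F); last by rewrite oppr_eq0 oner_eq0.
  by rewrite !(scalarE, basE); ring.
exists (s * p [<x, y>] + p [<x, t>]), (s * b + d).
apply: (frame_inj F); rewrite linearDr linearZr_LR !(scalarE, basE); first by ring.
  by rewrite -/a -/c sE; ring.
by rewrite -/b -/d; ring.
Qed.

(** The two conditions on [p] make the plane spanned by [e2] and [e3] an ideal. *)
Definition has_abelian_plane := exists e1 e2 e3 : A, exists p q r,
  [/\ frame e1 e2 e3 p q r, [<e2, e3>] = 0, p [<e1, e2>] = 0 & p [<e1, e3>] = 0].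

Definition has_sl2_basis := exists h e f : A,
  [/\ free [:: h; e; f], [<h, e>] = 2 *: e, [<h, f>] = - 2 *: f & [<e, f>] = h].

(** Here tau is [p] and t is [e1]: once the plane is abelian, ad e1 determines the bracket. *)
Lemma realization_abelian_frame (e1 e2 e3 : A) p q r : frame e1 e2 e3 p q r ->
  [<e2, e3>] = 0 -> p [<e1, e2>] = 0 -> p [<e1, e3>] = 0 ->
  (forall x y z, x ** [<y, z>] = 0) -> (forall x y, p (x ** y) = 0) ->
  has_novikov_poisson_realization A.
Proof.
move=> F b23 pb12 pb13 mul_br; apply: (realization_abelian (t := e1)) => // [x y|y].
all: have [E [p1 q1 r1] [p2 q2 r2] [p3 q3 r3]] := F.
all: have b1E z : [<e1, z>] = q z *: [<e1, e2>] + r z *: [<e1, e3>]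
  by rewrite {1}(E z) !linearDr !linearZr_LR tp_brxx /= scaler0 add0r.
  by apply: (frame_inj F); rewrite (b1E x) (b1E y) (frame_bilinear _ _ x y F)
    !tp_brxx (tp_brC e2 e1) (tp_brC e3 e1) (tp_brC e3 e2) b23 !scalarE; ring.
by rewrite b1E !scalarE pb12 pb13; ring.
Qed.

(** If ad t preserves the plane of x and y, that plane is the ideal. Otherwise [main] applies to w =
    t and to u, v, which are x, y in some order, with [w, u] outside the plane. By Jacobi [w, v] is
    a multiple of P = [w, u], so a suitable v' = v - k u is central; v' and P then span the abelian
    ideal, as [u, P] is a multiple of P. *)
Lemma commuting_plane x y t : free [:: x; y; t] -> [<x, y>] = 0 -> has_abelian_plane.
Proof.
have main (u v w : A) : free [:: u; v; w] -> [<u, v>] = 0 ->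
   (forall p q r, frame u v w p q r -> r [<w, u>] != 0) -> has_abelian_plane.
  move=> uvw buv nz; have [p [q [r F]]] := free_frame dimA uvw.
  have [E [p1 q1 r1] [p2 q2 r2] [p3 q3 r3]] := F.
  pose basE := (p1, p2, p3, q1, q2, q3, (r1, r2, r3)).
  have a0 := nz _ _ _ F.
  set P := [<w, u>] in a0 *; set a := r P in a0 *; pose k := r [<w, v>] / a.
  pose v' := v - k *: u.
  have J : a *: [<w, v>] = r [<w, v>] *: P.
    have := tp_jacobi w u v; rewrite buv linear0r add0r (tp_brC v w).
    rewrite linearNr /= {1}(E [<w, v>]) -/P {1}(E P) !linearDr !linearZr_LR /=.
    rewrite buv (tp_brC v u) buv !tp_brxx oppr0 !scaler0 !addr0 !add0r.
    rewrite (tp_brC u w) (tp_brC v w) -/P -/a !scalerN opprK.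
    by move=> /eqP; rewrite subr_eq0 => /eqP.
  have bwv' : [<w, v'>] = 0.
    rewrite /v' linearBr linearZr_LR /= -/P /k mulrC -scalerA -J scalerA.
    by rewrite mulVf // scale1r subrr.
  have buv' : [<u, v'>] = 0.
    by rewrite /v' linearBr linearZr_LR /= tp_brxx scaler0 buv subr0.
  have bPv' : [<v', P>] = 0.
    rewrite tp_brC {1}(E P) !linearDl !linearZl_LR /= bwv' buv'.
    by rewrite /v' linearBr linearZr_LR /= tp_brxx (tp_brC v u) buv
      !(oppr0, scaler0, subr0, addr0).
  have fr : free [:: u; v'; P].
    apply: (frame_free3 (d := a) F) => //.
    by rewrite /v' !(scalarE, basE) -/a; ring.
  have [p' [q' [r' F']]] := free_frame dimA fr.
  exists u, v', P, p', q', r'; split=> //; first by rewrite buv' scalarE.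
  rewrite {1}(E P) !linearDr !linearZr_LR /= buv tp_brxx (tp_brC u w) -/P.
  by rewrite !scalarE; case: F' => _ _ _ [-> _ _]; ring.
move=> xyt bxy; have [p [q [r F]]] := free_frame dimA xyt.
have frameU (u v w : A) p1 q1 r1 p2 q2 r2 :
    frame u v w p1 q1 r1 -> frame u v w p2 q2 r2 -> r1 =1 r2.
  move=> [E1 _ _ _] F2 z; rewrite {2}(E1 z).
  by have [_ _ ->] := frame_coef (p1 z) (q1 z) (r1 z) F2.
have [r10|r10] := eqVneq (r [<t, x>]) 0; last first.
  by apply: (main x y t) => // p' q' r' F'; rewrite -(frameU _ _ _ _ _ _ _ _ _ F F').
have [r20|r20] := eqVneq (r [<t, y>]) 0; last first.
  have yxt : free [:: y; x; t].
    by rewrite (perm_free (permEl (perm_catCA [:: y] [:: x] [:: t]))).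
  apply: (main y x t) => //; first by rewrite tp_brC bxy oppr0.
  move=> p' q' r' F'; suff F2 : frame y x t q p r.
    by rewrite -(frameU _ _ _ _ _ _ _ _ _ F2 F').
  by case: F => E [? ? ?] [? ? ?] [? ? ?]; split=> // z; rewrite {1}(E z) [X in X + _]addrC.
have txy : free [:: t; x; y].
  by rewrite (perm_free (permEl (perm_catC [:: t] [:: x; y]))).
exists t, x, y, r, p, q; split=> //.
by case: F => E [? ? ?] [? ? ?] [? ? ?]; split=> // z; rewrite {1}(E z) addrC addrA.
Qed.

(** By Jacobi [t, w] has no t component. If it has no u component either, t can be shifted by a
    multiple of u to commute with w, and the shifted vector and w span an abelian ideal. If it has
    one, ad u has eigenvalues 1, 0, -1 and the algebra is sl_2. *)
Lemma affine_plane (u w t : A) : free [:: u; w; t] -> [<u, w>] = w ->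
  has_abelian_plane \/ has_sl2_basis.
Proof.
move=> uwt buw; have [p [q [r F]]] := free_frame dimA uwt.
have [E [p1 q1 r1] [p2 q2 r2] [p3 q3 r3]] := F.
pose basE := (p1, p2, p3, q1, q2, q3, (r1, r2, r3)).
pose a1 := r [<t, u>]; pose a2 := p [<t, u>]; pose a3 := q [<t, u>].
pose b1 := r [<t, w>]; pose b2 := p [<t, w>]; pose b3 := q [<t, w>].
have btu : [<t, u>] = a2 *: u + a3 *: w + a1 *: t by exact: E.
have btw : [<t, w>] = b2 *: u + b3 *: w + b1 *: t by exact: E.
(* Jacobi for t, u, w, seen through a form: [r], [q] and [p] yield in turn [b10], [a2E] and the
   product relation on [b2]. *)
have J (l : {scalar A}) : b1 * l [<t, u>] + (1 - a1) * l [<t, w>] - (a2 + b3) * l w = 0.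
  have := tp_jacobi t u w; rewrite buw (tp_brC w t) linearNr /=.
  rewrite {2}btw btu !linearDr !linearZr_LR /= !tp_brxx buw (tp_brC w u) buw.
  rewrite (tp_brC u t) (tp_brC w t) => /(congr1 l); rewrite !scalarE => JJ.
  by rewrite -[RHS]JJ btu !scalarE; ring.
have b10 : b1 = 0.
  have := J r; rewrite r2 mulr0 subr0 -/a1 -/b1 => <-; ring.
have a2E : a2 = - a1 * b3.
  have := J q; rewrite q2 mulr1 -/a3 -/b3 b10 mul0r add0r => JJ.
  by apply/eqP; rewrite -subr_eq0 -oppr_eq0 -JJ; apply/eqP; ring.
have : b2 * (1 - a1) = 0.
  by have := J p; rewrite p2 mulr0 subr0 b10 mul0r add0r -/b2 mulrC.
move=> /eqP; have [b20 _|b20] := eqVneq b2 0.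
  left; pose t' := t - b3 *: u.
  have fr : free [:: u; w; t'].
    apply: (frame_free3 (d := 1) F); last exact: oner_neq0.
    by rewrite /t' !(scalarE, basE); ring.
  have [p' [q' [r' F']]] := free_frame dimA fr.
  exists u, w, t', p', q', r'; split=> //.
  - rewrite /t' linearBr linearZr_LR /= (tp_brC w t) (tp_brC w u) buw btw b20 b10.
    by rewrite !scale0r add0r addr0 scalerN opprK addNr.
  - by rewrite buw; case: F' => _ _ [].
  have -> : [<u, t'>] = - a3 *: w - a1 *: t'.
    rewrite /t' linearBr linearZr_LR /= tp_brxx (tp_brC u t) btu a2E.
    by apply: (frame_inj F); rewrite !(scalarE, basE); ring.
  by case: F' => _ _ [p'w _ _] [p't' _ _]; clearbody t'; rewrite !scalarE p'w p't'; ring.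
rewrite mulf_eq0 (negPf b20) /= subr_eq0 => /eqP a11; right.
have {a2E} a2E : a2 = - b3 by rewrite a2E -a11 mulN1r.
(* The third vector is the eigenvector of ad u for -1, scaled so that its bracket with w is 2 u. *)
exists (2 *: u), w, ((- 2 / b2) *: (t - b3 *: u + (a3 / 2) *: w)); split.
- apply: (frame_free3 (d := - 4 / b2) F).
    by rewrite !(scalarE, basE); ring.
  by rewrite mulf_neq0 ?invr_eq0 ?oppr_eq0 ?pnatr_eq0.
- by rewrite linearZl_LR /= buw.
- rewrite linearZl_LR linearZr_LR /= !(linearBr, linearDr) !linearZr_LR /=.
  rewrite tp_brxx buw (tp_brC u t) btu a2E -a11.
  by apply: (frame_inj F); rewrite !(scalarE, basE); field.
- rewrite linearZr_LR /= !(linearBr, linearDr) !linearZr_LR /=.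
  rewrite tp_brxx (tp_brC w u) (tp_brC w t) buw btw b10.
  by apply: (frame_inj F); rewrite !(scalarE, basE); field.
Qed.

(** A plane subalgebra either is abelian or has a basis with [u, w] = w, where w spans its derived
    algebra. *)
Lemma lie3_dichotomy : has_abelian_plane \/ has_sl2_basis.
Proof.
have [x [y [t [xyt [k [l bxy]]]]]] := subalgebra_dim2.
have [p [q [r F]]] := free_frame dimA xyt.
have [E [p1 q1 r1] [p2 q2 r2] [p3 q3 r3]] := F.
pose basE := (p1, p2, p3, q1, q2, q3, (r1, r2, r3)).
have [l0|l0] := eqVneq l 0; last first.
  apply: (@affine_plane (l^-1 *: x) (k *: x + l *: y) t).
    apply: (frame_free3 (d := 1) F); last exact: oner_neq0.
    by rewrite !(scalarE, basE); field.
  rewrite linearZl_LR /= linearDr !linearZr_LR /= tp_brxx scaler0 add0r bxy.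
  by rewrite scalerA mulVf // scale1r.
have [k0|k0] := eqVneq k 0.
  by left; apply: (commuting_plane xyt); rewrite bxy k0 l0 !scale0r addr0.
apply: (@affine_plane (- k^-1 *: y) x t).
  apply: (frame_free3 (d := k^-1) F); last by rewrite invr_eq0.
  by rewrite !(scalarE, basE); ring.
rewrite linearZl_LR /= (tp_brC y x) bxy l0 scale0r addr0 scaleNr scalerN opprK.
by rewrite scalerA mulVf // scale1r.
Qed.

End Lie3.

(** * The Lie algebra sl_2 *)

Section Sl2.
Variables (K : numClosedFieldType) (A : tpAlgebra K).
Hypothesis dimA : \dim {:A} = 3%N.

(** The arguments are the coordinates in the standard basis h, e, f of sl_2. *)
Definition sl2_mx (a b c : K) : 'M[K]_2 :=
  \matrix_(i, j) nth 0 (nth [::] [:: [:: a; b]; [:: c; - a]] i) j.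

Definition sl2_elt (a b c : K) : P19 K := vsproj (sl2 K) (sl2_mx a b c).

Lemma val_sl2_elt a b c : vsval (sl2_elt a b c) = sl2_mx a b c.
Proof.
rewrite vsprojK // mem_sl2 /mxtrace !big_ord_recl big_ord0 !mxE /=.
by rewrite addr0 subrr.
Qed.

Lemma mx2P (M N : 'M[K]_2) :
  [/\ M 0 0 = N 0 0, M 0 1 = N 0 1, M 1 0 = N 1 0 & M 1 1 = N 1 1] -> M = N.
Proof.
have I2 (i : 'I_2) : i = 0 \/ i = 1.
  by case: i => [[|[|//]] ?]; [left | right]; apply: val_inj.
by case=> E1 E2 E3 E4; apply/matrixP=> i j; case: (I2 i) (I2 j) => -> [] ->.
Qed.

Lemma sl2_elt_surj (x : P19 K) : exists a b c, x = sl2_elt a b c.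
Proof.
pose M := vsval x; exists (M 0 0), (M 0 1), (M 1 0); apply: val_inj.
rewrite [RHS]val_sl2_elt; apply: mx2P; rewrite !mxE /=; split=> //.
have := subvsP x; rewrite mem_sl2 /mxtrace !big_ord_recl big_ord0 addr0.
rewrite addrC addr_eq0 => /eqP E.
by rewrite -E; congr (vsval x _ _); apply: val_inj.
Qed.

Lemma sl2_elt_inj a b c a' b' c' : sl2_elt a b c = sl2_elt a' b' c' ->
  [/\ a = a', b = b' & c = c'].
Proof.
move/(congr1 vsval); rewrite !val_sl2_elt => /matrixP E.
by have := (E 0 0, E 0 1, E 1 0); rewrite !mxE /= => -[[-> ->] ->].
Qed.

Lemma sl2_eltP k a b c a' b' c' :
  k *: sl2_elt a b c + sl2_elt a' b' c' = sl2_elt (k * a + a') (k * b + b') (k * c + c').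
Proof.
apply: val_inj; rewrite [RHS]val_sl2_elt.
rewrite (_ : val _ = k *: sl2_mx a b c + sl2_mx a' b' c').
  by apply: mx2P; rewrite !mxE /=; split=> //; ring.
by rewrite -!val_sl2_elt.
Qed.

Lemma sl2_elt0 : sl2_elt 0 0 0 = 0.
Proof.
by apply: val_inj; rewrite [LHS]val_sl2_elt; apply: mx2P; rewrite !mxE /= oppr0.
Qed.

Lemma sl2_eltZ k a b c : k *: sl2_elt a b c = sl2_elt (k * a) (k * b) (k * c).
Proof. by have := sl2_eltP k a b c 0 0 0; rewrite sl2_elt0 !addr0. Qed.

Lemma br_sl2_elt a b c a' b' c' : [<sl2_elt a b c, sl2_elt a' b' c'>] =
  sl2_elt (b * c' - b' * c) (2 * (a * b' - a' * b)) (2 * (c * a' - c' * a)).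
Proof.
apply: val_inj; rewrite [LHS]val_sl2_br [RHS]val_sl2_elt !val_sl2_elt.
by apply: mx2P; rewrite !mxE !big_ord_recl !big_ord0 !mxE /=; split; ring.
Qed.

Lemma isomorphic_P19 : (forall x y : A, x ** y = 0) -> has_sl2_basis A ->
  tp_isomorphic A (P19 K).
Proof.
move=> mul0 [h [e [f [free3 bhe bhf bef]]]].
have [p [q [r F]]] := free_frame dimA free3.
have [E [p1 q1 r1] [p2 q2 r2] [p3 q3 r3]] := F.
pose phi x := sl2_elt (p x) (q x) (r x).
have phi_lin : linear phi by move=> k x y; rewrite /phi sl2_eltP !scalarE.
pose phiM := GRing.isLinear.Build K A (P19 K) *:%R phi phi_lin.
pose Phi : {linear A -> P19 K} := HB.pack phi phiM.
exists Phi; split.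
- have phi_surj y : exists x, phi x = y.
    have [a [b [c ->]]] := sl2_elt_surj y; exists (a *: h + b *: e + c *: f).
    by rewrite /phi; have [-> -> ->] := frame_coef a b c F.
  have [psi psiK] := choice phi_surj.
  exists psi => // x.
  by have /sl2_elt_inj[? ? ?] := psiK (phi x); apply: (frame_inj F).
- move=> x y; rewrite mul0 linear0; symmetry; exact: erefl.
- move=> x y; rewrite /= /phi br_sl2_elt; congr sl2_elt;
  by rewrite (frame_bilinear _ _ _ _ F) !tp_brxx (tp_brC e h) (tp_brC f h) (tp_brC f e)
    bhe bhf bef !scalarE !(p1, p2, p3, q1, q2, q3, r1, r2, r3); ring.
Qed.

Lemma sl2_basis_of_isomorphic : tp_isomorphic A (P19 K) -> has_sl2_basis A.
Proof.
case=> phi [[psi phiK psiK] _ phi_br].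
have brE u v : [<psi u, psi v>] = psi [<u, v>].
  by rewrite -(phiK [<psi u, psi v>]) phi_br !psiK.
pose S a b c := psi (sl2_elt a b c).
have SZ k a b c : S (k * a) (k * b) (k * c) = k *: S a b c.
  by apply: (can_inj phiK); rewrite linearZ /= !psiK sl2_eltZ.
exists (S 1 0 0), (S 0 1 0), (S 0 0 1); split.
- apply: free3P => a b c /(congr1 phi).
  rewrite linear0 !linearD !linearZ /= !psiK -addrA (sl2_eltZ c) !sl2_eltP -sl2_elt0.
  by case/sl2_elt_inj; rewrite !(mulr0, mulr1, addr0, add0r).
- rewrite brE br_sl2_elt -SZ /S; congr (psi (sl2_elt _ _ _)); ring.
- rewrite brE br_sl2_elt -SZ /S; congr (psi (sl2_elt _ _ _)); ring.
- rewrite brE br_sl2_elt /S; congr (psi (sl2_elt _ _ _)); ring.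
Qed.

End Sl2.

(** * Traces in a frame and nilpotency *)

Section FrameTrace.
Variables (K : numFieldType) (V : vectType K) (e1 e2 e3 : V) (p q r : {scalar V}).
Hypothesis F : frame e1 e2 e3 p q r.

(** The trace of an endomorphism, defined on bare functions so that composites need not be packaged
    as linear maps. *)
Definition frame_tr (f : V -> V) := p (f e1) + q (f e2) + r (f e3).

Lemma frame_linear (f : {linear V -> V}) (l : {scalar V}) x :
  l (f x) = p x * l (f e1) + q x * l (f e2) + r x * l (f e3).
Proof. by rewrite {1}(frameE F x) !linearD !linearZ. Qed.

Lemma frame_trC (f g : {linear V -> V}) :
  frame_tr (fun z => f (g z)) = frame_tr (fun z => g (f z)).
Proof.
rewrite /frame_tr (frame_linear f p (g e1)) (frame_linear f q (g e2)).
rewrite (frame_linear f r (g e3)) (frame_linear g p (f e1)).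
rewrite (frame_linear g q (f e2)) (frame_linear g r (f e3)); ring.
Qed.

(* Cayley--Hamilton, with the coefficients in terms of power traces. *)
Lemma nilpotent_of_traces (f : {linear V -> V}) :
  frame_tr f = 0 -> frame_tr (fun z => f (f z)) = 0 ->
  frame_tr (fun z => f (f (f z))) = 0 -> forall x, f (f (f x)) = 0.
Proof.
have [_ [p1 q1 r1] [p2 q2 r2] [p3 q3 r3]] := F.
have pf x := frame_linear f p x; have qf x := frame_linear f q x.
have rf x := frame_linear f r x.
rewrite /frame_tr.
move: (p (f e1)) (p (f e2)) (p (f e3)) pf => a11 a12 a13 pf.
move: (q (f e1)) (q (f e2)) (q (f e3)) qf => a21 a22 a23 qf.
move: (r (f e1)) (r (f e2)) (r (f e3)) rf => a31 a32 a33 rf.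
rewrite !(pf, qf, rf) p1 q1 r1 p2 q2 r2 p3 q3 r3 => t1 t2 t3 x.
(* The traces stay polynomials in the nine entries while [CH] is proved as an identity; that they
   vanish is used only afterwards. *)
set T1 := (X in X = 0) in t1; set T2 := (X in X = 0) in t2.
set T3 := (X in X = 0) in t3.
have CH (l : {scalar V}) : 
   [\/ l =1 p, l =1 q | l =1 r] ->
   l (f (f (f x))) = T1 * l (f (f x)) - (T1 ^+ 2 - T2) / 2 * l (f x)
     + (T1 ^+ 3 - 3 * T1 * T2 + 2 * T3) / 6 * l x.
  by rewrite /T1 /T2 /T3 => -[] lE; rewrite !lE !(pf, qf, rf); field.
have Z (l : {scalar V}) (lE : [\/ l =1 p, l =1 q | l =1 r]) : l (f (f (f x))) = 0.
  by rewrite (CH l lE) t1 t2 t3; ring.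
apply: (frame_inj F); rewrite scalarE; apply: Z.
- by constructor 1.
- by constructor 2.
- by constructor 3.
Qed.

End FrameTrace.

(** * Non-existence of a realization on sl_2 *)

Section NoRealization.
Variables (K : numClosedFieldType) (A : tpAlgebra K).
Hypothesis dimA : \dim {:A} = 3%N.

Lemma sl2_basis_no_realization : has_sl2_basis A -> ~ has_novikov_poisson_realization A.
Proof.
case=> h [e [f [free3 bhe bhf bef]]] [circ [[_ [lsa rcomm] _ _] brE]].
have [p [q [r F]]] := free_frame dimA free3.
have [E [p1 q1 r1] [p2 q2 r2] [p3 q3 r3]] := F.
pose tr := frame_tr h e f p q r.
have trE g g' : g =1 g' -> tr g = tr g' by move=> gg; rewrite /tr /frame_tr !gg.
have trC (g g' : {linear A -> A}) : tr (fun z => g (g' z)) = tr (fun z => g' (g z)).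
  exact: (frame_trC F).
have trD g g' : tr (fun z => g z + g' z) = tr g + tr g'.
  by rewrite /tr /frame_tr !scalarE; ring.
have trN g : tr (fun z => - g z) = - tr g by rewrite /tr /frame_tr !scalarE; ring.
have trZ k g : tr (fun z => k *: g z) = k * tr g.
  by rewrite /tr /frame_tr !scalarE; ring.
pose L x : {linear A -> A} := circ x.
pose R y : {linear A -> A} := applyr circ y.
(* Left symmetry says that L is a representation of the Lie algebra. *)
have brL u v z : circ [<u, v>] z = L u (L v z) - L v (L u z).
  rewrite brE linearBl /=; have /eqP := lsa u v z; rewrite subr_eq => /eqP ->.
  by rewrite addrAC [X in X + _]addrAC subrr add0r addrC.
(* Each of h, e, f is a commutator up to a nonzero scalar, and L sends commutators to
   commutators. *)
have trL0 u : tr (circ u) = 0.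
  have trLbr x y : tr (circ [<x, y>]) = 0.
    by rewrite (trE _ _ (brL x y)) trD trN trC subrr.
  have trLZ k x : k != 0 -> tr (circ (k *: x)) = 0 -> tr (circ x) = 0.
    move=> k0; rewrite (trE _ (fun z => k *: circ x z)).
      by rewrite trZ => /eqP; rewrite mulf_eq0 (negPf k0) => /eqP.
    by move=> z; rewrite linearZl_LR.
  have Lh : tr (circ h) = 0 by rewrite -bef.
  have Le : tr (circ e) = 0.
    by apply: (trLZ 2); rewrite ?pnatr_eq0 // -bhe.
  have Lf : tr (circ f) = 0.
    by apply: (trLZ (- 2)); rewrite ?oppr_eq0 ?pnatr_eq0 // -bhf.
  rewrite (trE _ (fun z => p u *: circ h z + q u *: circ e z + r u *: circ f z)).
    by rewrite !trD !trZ Lh Le Lf !mulr0 !addr0.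
  by move=> z; rewrite {1}(E u) !linearDl !linearZl_LR.
have trad u : tr (tp_br A u) = 0.
  rewrite /tr /frame_tr (frame_bilinear _ p u h F) (frame_bilinear _ q u e F).
  rewrite (frame_bilinear _ r u f F) !tp_brxx.
  rewrite (tp_brC e h) (tp_brC f h) (tp_brC f e) bhe bhf bef.
  by rewrite !scalarE p1 q1 r1 p2 q2 r2 p3 q3 r3; ring.
have trR u : tr (R u) = 0.
  rewrite (trE _ (fun z => circ u z - [<u, z>])); first by rewrite trD trN trL0 trad subrr.
  by move=> z; rewrite brE opprB addrC subrK.
(* Left symmetry again, now read as a relation between R_y R_x, R_{x o y} and the commutator of L_x
   and R_y. *)
have RR x y z : R y (R x z) = R (circ x y) z - L x (R y z) + R y (L x z).
  have := lsa z x y; rewrite /R /L /=.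
  by move=> /eqP; rewrite subr_eq => /eqP ->; rewrite addrC [X in _ + X]addrC addrA.
have trRR x y : tr (fun z => R y (R x z)) = 0.
  by rewrite (trE _ _ (RR x y)) !trD trN trR (trC (L x)) sub0r addNr.
(* With [RR] applied after an inner R_x, the first term is traceless by [trRR] and the other two
   cancel by cyclicity of the trace. *)
have trRRR x : tr (fun z => R x (R x (R x z))) = 0.
  rewrite (trE _ _ (fun z => RR x x (R x z))) !trD trN (trRR x (circ x x)).
  by rewrite (trC (R x) (L x \o R x)%FUN) sub0r addNr.
have Rnil x z : R x (R x (R x z)) = 0.
  exact: (nilpotent_of_traces F (trR x) (trRR x x) (trRRR x)).
(* As R_w is nilpotent, the last nonzero vector among z, R_w z, R_w^2 z is killed by R_w. Right
   commutativity preserves earlier relations, so h, e and f can be treated in succession to reach v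
   with L_v = 0. *)
have kerR w z : z != 0 -> exists v, [/\ v != 0, circ v w = 0 &
    forall y, circ z y = 0 -> circ v y = 0].
  move=> z0; have [z1|z1] := eqVneq (circ z w) 0; first by exists z.
  have st v y : circ v y = 0 -> circ (circ v w) y = 0.
    by rewrite rcomm => ->; rewrite linear0l.
  have [z2|z2] := eqVneq (circ (circ z w) w) 0.
    by exists (circ z w); split=> // y /st.
  exists (circ (circ z w) w); split=> //; first exact: (Rnil w z).
  by move=> y /st /st.
have h0 : h != 0.
  by apply/eqP => h0; have := oner_neq0 K; rewrite -p1 h0 scalarE eqxx.
have [v1 [v10 v1h _]] := kerR h h h0.
have [v2 [v20 v2e v2y]] := kerR e v1 v10.
have [v [v0 vf vy]] := kerR f v2 v20.
(* The kernel of L; by [brL] it is an ideal for the bracket. *)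
pose I u := forall y, circ u y = 0.
have Iv : I v.
  move=> y; rewrite (E y) !linearDr !linearZr_LR /= vf.
  by rewrite (vy e) // (vy h) ?scaler0 ?addr0 // v2y.
have Ibr x u : I u -> I [<x, u>].
  by move=> Iu y; rewrite brL /L /= !Iu linear0r subrr.
have IZ k u : k != 0 -> I (k *: u) -> I u.
  move=> k0 Iku y; have /eqP := Iku y.
  by rewrite linearZl_LR /= scaler_eq0 (negPf k0) => /eqP.
have beh : [<e, h>] = - 2 *: e by rewrite tp_brC bhe scaleNr.
have bev : [<e, v>] = (- 2 * p v) *: e + r v *: h.
  rewrite {1}(E v) !linearDr !linearZr_LR /= tp_brxx scaler0 addr0 beh bef.
  by rewrite scalerA mulrC.
(* Among [e, [e, v]], [e, v] and v itself, at least one is a nonzero multiple of e, according to the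
   last nonzero coordinate of v in the order e, h, f. *)
have Ie : I e.
  have [rv0|rv0] := eqVneq (r v) 0; last first.
    apply: (IZ (- 2 * r v)); first by rewrite mulf_neq0 ?oppr_eq0 ?pnatr_eq0.
    have <- : [<e, [<e, v>]>] = (- 2 * r v) *: e; last by apply/Ibr/Ibr.
    by rewrite bev linearDr !linearZr_LR /= tp_brxx scaler0 add0r beh scalerA mulrC.
  have [pv0|pv0] := eqVneq (p v) 0; last first.
    apply: (IZ (- 2 * p v)); first by rewrite mulf_neq0 ?oppr_eq0 ?pnatr_eq0.
    have <- : [<e, v>] = (- 2 * p v) *: e; last by apply: Ibr.
    by rewrite bev rv0 scale0r addr0.
  have vE : v = q v *: e by rewrite {1}(E v) pv0 rv0 !scale0r addr0 add0r.
  apply: (IZ (q v)); last by rewrite -vE.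
  by apply: contra v0 => /eqP qv0; rewrite vE qv0 scale0r.
have Ih : I h.
  have bfe : [<f, e>] = (- 1) *: h by rewrite tp_brC bef scaleN1r.
  by apply: (IZ (- 1)); rewrite ?oppr_eq0 ?oner_neq0 // -bfe; apply: Ibr.
have If : I f.
  have bfh : [<f, h>] = 2 *: f by rewrite tp_brC bhf scaleNr opprK.
  by apply: (IZ 2); rewrite ?pnatr_eq0 // -bfh; apply: Ibr.
by move/eqP: h0; apply; rewrite -bef brE Ie If subrr.
Qed.

End NoRealization.

(** * Algebras with an idempotent *)

Section Cases.
Variables (K : numClosedFieldType) (A : tpAlgebra K).
Hypothesis dimA : \dim {:A} = 3%N.
Implicit Types x y z : A.

Lemma dependent4 (x1 x2 x3 x4 : A) : exists a b c d : K,
  a *: x1 + b *: x2 + c *: x3 + d *: x4 = 0 /\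
  [|| a != 0, b != 0, c != 0 | d != 0].
Proof.
have [fr|nfr] := boolP (free [:: x1; x2; x3]); last first.
  apply: contrapT => H; case/negP: nfr; apply: free3P => a b c abc.
  have [/and3P[/eqP ? /eqP ? /eqP ?] //|] := boolP [&& a == 0, b == 0 & c == 0].
  rewrite !negb_and => n0; case: H; exists a, b, c, 0; rewrite scale0r addr0.
  by split=> //; move: n0; rewrite eqxx orbF.
have [p [q [r [E _ _ _]]]] := free_frame dimA fr.
exists (p x4), (q x4), (r x4), (-1).
by rewrite scaleN1r -E subrr oppr_eq0 oner_neq0 !orbT.
Qed.

(* If z^4 <> 0, a dependency between z, z^2, z^3, z^4 rewrites as z^3 w = z^3
   with w a polynomial in z without constant term, and then w^3 is idempotent. *)
Lemma nilpotent_or_idempotent z : z ** z ** (z ** z) = 0 \/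
  exists g, [/\ g != 0, g ** g = g & forall y, y ** z = 0 -> y ** g = 0].
Proof.
have [a [b [c [d [rel nz]]]]] := dependent4 z (z ** z) (z ** z ** z) (z ** z ** z ** z).
suff [z40|[al [be [ga zw]]]] : z ** z ** (z ** z) = 0 \/ exists al be ga : K,
    z ** z ** z ** (al *: z + be *: (z ** z) + ga *: (z ** z ** z)) = z ** z ** z.
- by left.
- set w := (X in _ ** X = _) in zw.
  have wE y : y ** w = al *: (y ** z) + be *: (y ** z ** z) + ga *: (y ** z ** z ** z).
    by rewrite /w !linearDr !linearZr_LR /= !tp_mulA.
  (* Since [y ** w] is a combination of multiples of [y ** z], invariance under w passes from one to
     the other. Three uses trade z^3 for w^3. *)
  have step y : y ** z ** w = y ** z -> y ** w ** w = y ** w.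
    move=> yz; have yzu u : y ** z ** u ** w = y ** z ** u by rewrite tp_mulAC yz.
    have yzuu u v : y ** z ** u ** v ** w = y ** z ** u ** v by rewrite tp_mulAC yzu.
    by rewrite (wE y) !linearDl !linearZl_LR /= yz yzu yzuu.
  have J1 := step _ zw.
  have J2 : z ** w ** w ** w = z ** w ** w.
    by apply: step; rewrite (tp_mulAC z w) J1.
  have J3 : w ** w ** w ** w = w ** w ** w.
    by apply: step; have -> : w ** w ** z = z ** w ** w; rewrite // tp_mulC tp_mulA.
  have [g0|g0] := eqVneq (w ** w ** w) 0.
    left; have z3 : z ** z ** z = z ** z ** z ** (w ** w ** w) by rewrite !tp_mulA !zw.
    by rewrite tp_mulA z3 g0 linear0r linear0l.
  right; exists (w ** w ** w); split=> //.
    by rewrite !tp_mulA !J3.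
  by move=> y yz; rewrite !tp_mulA (wE y) yz !linear0l !scaler0 !addr0 !linear0l.
pose z3 := z ** z ** z.
have main k k1 k2 k3 : k != 0 ->
    k *: z3 + k1 *: (z3 ** z) + k2 *: (z3 ** z ** z) + k3 *: (z3 ** z ** z ** z) = 0 ->
    exists al be ga : K,
      z3 ** (al *: z + be *: (z ** z) + ga *: (z ** z ** z)) = z3.
  move=> k0 rk; exists (- k1 / k), (- k2 / k), (- k3 / k).
  rewrite !linearDr !linearZr_LR /= !tp_mulA; apply: (scalerI k0).
  rewrite !scalerDr !scalerA ![k * _]mulrC !divfK //.
  apply/esym/eqP; rewrite -subr_eq0 !opprD !addrA -!scaleNr !opprK.
  by rewrite rk.
have times y : a *: (y ** z) + b *: (y ** z ** z) + c *: (y ** z ** z ** z)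
    + d *: (y ** z ** z ** z ** z) = 0.
  have := congr1 (fun u => y ** u) rel.
  by rewrite linear0r !linearDr !linearZr_LR /= !tp_mulA.
(* The first nonzero coefficient decides: the relation is multiplied by the power of z that makes it
   start at z^3. If only d survives, z^4 = 0. *)
have [a0|a0] := eqVneq a 0; last by right; apply: (main a b c d) => //; exact: times.
move: rel times; rewrite a0 scale0r add0r => rel times.
have [b0|b0] := eqVneq b 0.
  move: rel times; rewrite b0 scale0r add0r => rel times.
  have [c0|c0] := eqVneq c 0.
    move: nz rel; rewrite a0 b0 c0 eqxx /= scale0r add0r => d0 /(scaler_eq0_vector d0).
    by rewrite tp_mulA; left.
  right; apply: (main c d 0 0) => //; rewrite !scale0r !addr0; exact: rel.
right; apply: (main b c d 0) => //; rewrite scale0r addr0.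
have := times z; rewrite scale0r add0r; exact.
Qed.

(** Here A_0 is spanned by t and w. If its elements all act on it with zero diagonal, w annihilates
    A, and e, w span an abelian ideal containing all products. Otherwise A_0 has an idempotent g
    acting on it as the identity, so e + g is a unit of A and [realization_idempotent] applies with
    zero complement. *)
Lemma realization_idempotent_affine (e t w : A) d : d != 0 ->
  free [:: t; e; w] -> e ** e = e -> e ** t = 0 -> e ** w = 0 ->
  [<t, w>] = d *: w -> has_novikov_poisson_realization A.
Proof.
move=> d0 fr ee et ew btw; have [p [q [r F]]] := free_frame dimA fr.
have [E [p1 q1 r1] [p2 q2 r2] [p3 q3 r3]] := F.
have e0 : e != 0.
  by apply/eqP => e0; have := oner_neq0 K; rewrite -q2 e0 scalarE eqxx.
have w0 : w != 0.
  by apply/eqP => w0; have := oner_neq0 K; rewrite -r3 w0 scalarE eqxx.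
have bet : [<e, t>] = 0 by apply: (br_idempotent ee).
have bew : [<e, w>] = 0 by apply: (br_idempotent ee).
have ann z : e ** z = 0 -> z = p z *: t + r z *: w.
  move=> ez; rewrite {1}(E z); suff -> : q z = 0 by rewrite scale0r addr0.
  apply: (scaler_eq0_scalar e0); rewrite -[RHS]ez {2}(E z) !linearDr !linearZr_LR /=.
  by rewrite et ew ee !scaler0 add0r addr0.
(* The Leibniz rule makes z act on <t, w> by a triangular matrix with equal
   diagonal entries. *)
have act z : e ** z = 0 -> z ** t = p (z ** t) *: t + r (z ** t) *: w
                        /\ z ** w = p (z ** t) *: w.
  move=> ez; have zt : e ** (z ** t) = 0 by rewrite tp_mulCA et linear0r.
  have zw : e ** (z ** w) = 0 by rewrite tp_mulCA ew linear0r.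
  have ztE := ann _ zt; have zwE := ann _ zw.
  have L := tp_leibniz z t w; rewrite btw ztE zwE linearZr_LR /= zwE in L.
  rewrite !linearDl !linearDr !linearZl_LR !linearZr_LR /= !tp_brxx btw !scaler0 in L.
  rewrite addr0 add0r in L.
  have Lp := congr1 p L; have Lr := congr1 r L.
  move: Lp Lr; rewrite mulr2n !(scalarE, p1, p3, r1, r3).
  rewrite !(mulr0, mulr1, add0r, addr0) => /eqP.
  have d2 : d + d != 0 by rewrite -mulr2n mulrn_eq0.
  rewrite -mulrDl mulf_eq0 (negPf d2) => /= /eqP Lp Lr.
  have {}Lr : r (z ** w) = p (z ** t).
    apply: (mulfI d0); apply: (addIr (r (z ** w) * d)).
    by rewrite [d * p _]mulrC -Lr; ring.
  by split=> //; apply: (etrans zwE); rewrite Lp Lr scale0r add0r.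
have [nil|] := pselect (forall z, e ** z = 0 -> p (z ** t) = 0).
  have actw z : e ** z = 0 -> z ** w = 0.
    by move=> ez; have [_ ->] := act z ez; rewrite nil // scale0r.
  have tw := actw t et; have ww := actw w ew.
  have t2 : t ** t = r (t ** t) *: w.
    by apply: (etrans (act t et).1); rewrite nil // scale0r add0r.
  have mulw u : u ** w = 0.
    by rewrite (E u) !linearDl !linearZl_LR /= tw ew ww !scaler0 !addr0.
  apply: (realization_abelian_frame F bew).
  - by rewrite tp_brC bet oppr0 scalarE.
  - by rewrite btw scalarE p3 mulr0.
  - move=> u x y; suff -> : [<x, y>] = r [<x, y>] *: w.
      by rewrite linearZr_LR /= mulw scaler0.
    apply: (frame_inj F); rewrite !(frame_bilinear _ _ x y F) !tp_brxx.
    + by rewrite (tp_brC t e) (tp_brC w e) (tp_brC w t) bet bew btw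
        !(scalarE, p3); ring.
    + by rewrite (tp_brC t e) (tp_brC w e) (tp_brC w t) bet bew btw
        !(scalarE, q3); ring.
    + by rewrite scalarE r3 mulr1.
  - move=> x y; rewrite (frame_bilinear _ _ x y F) ee et (tp_mulC t e) et ew.
    by rewrite (tp_mulC w e) ew (tp_mulC w t) tw ww t2 !(scalarE, p2, p3); ring.
move=> /existsNP[z /not_implyP[ez /eqP zt0]].
have [[zt zw] k0] := (act z ez, zt0); set k := p (z ** t) in zt zw k0.
have [z4|[g [g0 gg zg]]] := nilpotent_or_idempotent z.
  have : z ** z ** (z ** z) ** w = 0 by rewrite z4 linear0l.
  rewrite -!tp_mulA zw !linearZr_LR /= zw !linearZr_LR /= zw linearZr_LR /= zw.
  by rewrite !scalerA => /(scaler_eq0_scalar w0)/eqP; rewrite !mulf_eq0 (negPf k0).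
have eg : e ** g = 0 by exact: zg.
have [gt gw] := act g eg; move: gt gw.
set a := p (g ** t); set b := r (g ** t) => gt gw.
have aa : a * a = a.
  apply/eqP; rewrite -subr_eq0; apply/eqP/(scaler_eq0_scalar w0).
  by rewrite scalerBl -scalerA -{1}gw -linearZr_LR -gw tp_mulA gg subrr.
(* If a = 0, then g = g g is a multiple of w, which g kills, so g would vanish. *)
have [a0|a0] := eqVneq a 0.
  case/eqP: g0; have gE : g = (p g * b) *: w.
    rewrite -{1}gg {2}(ann g eg) linearDr !linearZr_LR /= gt gw a0.
    by rewrite !scale0r scaler0 add0r addr0 scalerA.
  by rewrite -gg {2}gE linearZr_LR /= gw a0 scale0r scaler0.
have a1 : a = 1 by apply: (mulfI a0); rewrite aa mulr1.
have b0 : b = 0.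
  have ggt : g ** (g ** t) = g ** t by rewrite tp_mulA gg.
  apply: (scaler_eq0_scalar w0); move: ggt; rewrite gt linearDr !linearZr_LR /= gt gw a1.
  by rewrite !scale1r -[RHS]addr0 => /addrI.
have unit x : (e + g) ** x = x.
  rewrite {2}(E x) {1}(E x) !linearDr !linearZr_LR /= !linearDl /=.
  by rewrite et ee ew gt gw (tp_mulC g e) eg a1 b0 scale0r !scale1r !add0r !addr0.
by apply: (@realization_idempotent _ _ (e + g)) => // x y; rewrite unit => -> _; rewrite linear0l.
Qed.

(** If A_0 is not abelian, it is a plane spanned by some x and y, and by Leibniz it contains w =
    [x, y]. One of x, y is independent of w and brackets with w to a nonzero multiple of w. *)
Lemma realization_of_idempotent (e : A) : e != 0 -> e ** e = e ->
  has_novikov_poisson_realization A.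
Proof.
move=> e0 ee.
have [br0|] := pselect (forall x y, e ** x = 0 -> e ** y = 0 -> [<x, y>] = 0).
  exact: realization_idempotent ee br0.
move=> /existsNP[x /existsNP[y /not_implyP[ex /not_implyP[ey /eqP]]]].
set w := [<x, y>] => w0.
have fr : free [:: e; x; y].
  apply: free3P => a b c rel.
  have a0 : a = 0.
    apply: (scaler_eq0_scalar e0); have := congr1 (fun u => e ** u) rel.
    by rewrite linear0r !linearDr !linearZr_LR /= ee ex ey !scaler0 !addr0.
  move: rel; rewrite a0 scale0r add0r => rel; split=> //; apply: (scaler_eq0_scalar w0).
    have := congr1 (fun u => [<u, y>]) rel.
    by rewrite linear0l linearDl !linearZl_LR /= tp_brxx scaler0 addr0.
  have := congr1 (fun u => [<x, u>]) rel.
  by rewrite linear0r linearDr !linearZr_LR /= tp_brxx scaler0 add0r.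
have [p [q [r F]]] := free_frame dimA fr.
have [E [p1 q1 r1] [p2 q2 r2] [p3 q3 r3]] := F.
have ew : e ** w = 0.
  by apply: (@mulr2I _ A); rewrite tp_leibniz ex ey linear0l linear0r addr0 mul0rn.
have pw : p w = 0.
  apply: (scaler_eq0_scalar e0); rewrite -[RHS]ew {2}(E w) !linearDr !linearZr_LR /=.
  by rewrite ee ex ey !scaler0 !addr0.
have wE : w = q w *: x + r w *: y by rewrite {1}(E w) pw scale0r add0r.
have [r0|r0] := eqVneq (r w) 0; last first.
  apply: (@realization_idempotent_affine e x w (r w)) => //.
    apply: (frame_free3 (d := - r w) F); last by rewrite oppr_eq0.
    by rewrite !(p1, p2, p3, q1, q2, q3, (r1, r2, r3), pw); ring.
  by rewrite {1}wE linearDr !linearZr_LR /= tp_brxx scaler0 add0r.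
have q0 : q w != 0.
  by apply: contra w0 => /eqP q0; rewrite wE q0 r0 !scale0r addr0.
apply: (@realization_idempotent_affine e y w (- q w)); rewrite ?oppr_eq0 //.
  apply: (frame_free3 (d := q w) F) => //.
  by rewrite !(p1, p2, p3, q1, q2, q3, (r1, r2, r3), pw); ring.
rewrite {1}wE linearDr !linearZr_LR /= tp_brxx scaler0 addr0 (tp_brC y x) -/w.
by rewrite scalerN scaleNr.
Qed.

End Cases.

(** * Algebras without idempotents *)

Section Nilpotent.
Variables (K : numClosedFieldType) (A : tpAlgebra K).
Hypothesis dimA : \dim {:A} = 3%N.
Implicit Types x y z : A.

(** In the basis x, x^2, x^3, the Leibniz rule derives every bracket from [x, x^2]. Applied to x, x
    and x^3, it gives 6 a0 = 0 for the x coordinate a0 of [x, x^2]. *)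
Lemma realization_cube_neq0 x : x ** x ** x != 0 -> x ** x ** (x ** x) = 0 ->
  has_novikov_poisson_realization A.
Proof.
set e2 := x ** x; set e3 := e2 ** x => e30 m22.
have m12 : x ** e2 = e3 by rewrite tp_mulC.
have m13 : x ** e3 = 0 by rewrite -m12 tp_mulA.
have m23 : e2 ** e3 = 0 by rewrite /e3 tp_mulA m22 linear0l.
have m33 : e3 ** e3 = 0 by rewrite {2}/e3 tp_mulA (tp_mulC e3) m23 linear0l.
have fr : free [:: x; e2; e3].
  apply: free3P => a b c rel.
  have a0 : a = 0.
    apply: (scaler_eq0_scalar e30); have := congr1 (fun u => e2 ** u) rel.
    rewrite linear0r !linearDr !linearZr_LR /= (tp_mulC e2 x) m12 m22 m23.
    by rewrite !scaler0 !addr0.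
  move: rel; rewrite a0 scale0r add0r => rel.
  have b0 : b = 0.
    apply: (scaler_eq0_scalar e30); have := congr1 (fun u => x ** u) rel.
    by rewrite linear0r !linearDr !linearZr_LR /= m12 m13 !scaler0 !addr0.
  move: rel; rewrite b0 scale0r add0r => rel.
  by split=> //; apply: (scaler_eq0_scalar e30).
have [p [q [r F]]] := free_frame dimA fr.
have [E [p1 q1 r1] [p2 q2 r2] [p3 q3 r3]] := F.
have b12 := E [<x, e2>].
set a0 := p _ in b12; set a := q _ in b12; set b := r _ in b12.
have b13 : [<x, e3>] = (2 * a0) *: e2 + (2 * a) *: e3.
  have := tp_leibniz x x e2; rewrite tp_brxx add0r m12 => <-.
  rewrite b12 !linearDr !linearZr_LR /= m12 m13 scaler0 addr0 -/e2.
  by rewrite mulrnDl -!scaler_nat !scalerA.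
have b23 : [<e2, e3>] = (- 2 * a0) *: e3.
  have := tp_leibniz e2 x e2; rewrite m22 linear0r addr0 -/e3 (tp_brC e3 e2).
  rewrite b12 !linearDr !linearZr_LR /= (tp_mulC e2 x) m12 m22 m23 !scaler0 !addr0.
  by move=> H; rewrite mulNr scaleNr -scalerA scaler_nat H opprK.
have a00 : a0 = 0.
  have := tp_leibniz x x e3; rewrite m13 linear0r addr0 b23 b13.
  rewrite !linearDr !linearZr_LR /= m12 m13 scaler0 addr0 => /(congr1 r).
  rewrite -scaler_nat !scalarE r3 => H.
  have : 6 * a0 = 0.
    have -> : 6 * a0 = 2 * (2 * a0 * 1) - - 2 * a0 * 1 by ring.
    by rewrite H subrr.
  by move/eqP; rewrite mulf_eq0 pnatr_eq0 => /eqP.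
apply: (@realization_nilpotent_chain _ _ x e2 e3 p q r a b F) => //.
- move=> u; rewrite (E u) !linearDl !linearZl_LR /= m13 m23 m33.
  by rewrite !scaler0 !addr0.
- by rewrite b12 a00 scale0r add0r.
- by rewrite b13 a00 mulr0 scale0r add0r.
- by rewrite b23 a00 mulr0 scale0r.
Qed.

(** Polarization: the cubes of x + y and x - y give x^2 y = 0, and then (x + y)^2 z = 0 gives 2 x y
    z = 0. *)
Lemma mul3_eq0 : (forall x, x ** x ** x = 0) -> forall x y z, x ** y ** z = 0.
Proof.
move=> cube.
have sum0 x y : x ** x ** y + x ** y ** y = 0.
  have := cube (x + y); rewrite !(linearDl, linearDr) /= !cube.
  rewrite (tp_mulAC x y x) (tp_mulC y x) (tp_mulAC x y x).
  rewrite (tp_mulC (y ** y) x) !tp_mulA !add0r !addr0 => H.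
  apply: (@scaler_eq0_vector _ _ 3); first by rewrite pnatr_eq0.
  rewrite -H scaler_nat !mulrS mulr0n.
  move: (x ** x ** y) (x ** y ** y) => P Q; rewrite addr0 !addrA.
  by rewrite -!addrA; congr (_ + _); rewrite [in LHS]addrCA; congr (_ + _); rewrite addrCA.
have sq x y : x ** x ** y = 0.
  have := sum0 x (- y); rewrite !linearNr /= linearNl opprK addrC => /eqP.
  rewrite subr_eq0 => /eqP QP; apply: (@mulr2I _ A).
  by rewrite mul0rn mulr2n -{2}QP sum0.
move=> x y z; apply: (@mulr2I _ A); rewrite mul0rn.
have := sq (x + y) z; rewrite !(linearDl, linearDr) /= !sq.
by rewrite (tp_mulC y x) add0r addr0 mulr2n.
Qed.

(** Leibniz and Jacobi force the brackets required by [realization_conformal], unless g and the t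
    coordinate m of [t, f] both vanish; then f and c span an abelian ideal. *)
Lemma realization_metric (t f c : A) g : free [:: t; f; c] ->
  t ** t = c -> t ** f = 0 -> f ** f = g *: c -> (forall x, x ** c = 0) ->
  has_novikov_poisson_realization A.
Proof.
move=> fr mtt mtf mff mc; have [p [q [r F]]] := free_frame dimA fr.
have [E [p1 q1 r1] [p2 q2 r2] [p3 q3 r3]] := F.
have c0 : c != 0.
  by apply/eqP => c0; have := oner_neq0 K; rewrite -r3 c0 scalarE eqxx.
have mft : f ** t = 0 by rewrite tp_mulC.
have btf := E [<t, f>].
set m := p _ in btf; set b := q _ in btf; set a := r _ in btf.
have bfc : [<f, c>] = (- (2 * m)) *: c.
  have := tp_leibniz t t f; rewrite mtf linear0r addr0 mtt (tp_brC c f) => H.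
  rewrite scaleNr -scalerA scaler_nat -[LHS]opprK -H btf.
  by rewrite !linearDr !linearZr_LR /= mtt mtf mc !scaler0 !addr0.
have btc := E [<t, c>].
have ptc : p [<t, c>] = 0.
  have L := tp_leibniz t t c; rewrite mtt tp_brxx mc linear0r addr0 in L.
  rewrite btc !linearDr !linearZr_LR /= mtt mtf mc !scaler0 !addr0 in L.
  apply: (scaler_eq0_scalar c0); apply: (@mulr2I _ A); by rewrite L mul0rn.
move: btc; rewrite ptc scale0r add0r; set k := q _; set l := r _ => btc.
suff [btc2|[g0 m0]] : [<t, c>] = (2 * b) *: c \/ g = 0 /\ m = 0.
- exact: (realization_conformal F mtt mtf mff mc btf).
- have bfc0 : [<f, c>] = 0 by rewrite bfc m0 mulr0 oppr0 scale0r.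
  have mE u v : u ** v = (p u * p v) *: c.
    rewrite {1}(E u) {1}(E v) !linearDl !linearZl_LR /= !linearDr !linearZr_LR /=.
    rewrite !mc !(tp_mulC c) !mc mtt mtf mft mff g0.
    by rewrite !(scale0r, scaler0, addr0) scalerA.
  have pbr u v : p [<u, v>] = 0.
    rewrite (frame_bilinear _ _ u v F) !tp_brxx (tp_brC f t) (tp_brC c t) (tp_brC c f).
    by rewrite bfc0 !scalarE ptc -/m m0; ring.
  apply: (realization_abelian_frame F bfc0) => // [u v w|u v].
    by rewrite mE pbr mulr0 scale0r.
  by rewrite mE scalarE p3 mulr0.
(* For g nonzero, Leibniz for f, t, f determines [t, c]; for g = 0 and m nonzero, Jacobi for t, f, c
   does. *)
have [g0|g0] := eqVneq g 0; last first.
  left; apply: (scalerI g0).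
  have := tp_leibniz f t f; rewrite mft linear0l add0r mff linearZr_LR /= => <-.
  rewrite btf !linearDr !linearZr_LR /= mft mff mc !scaler0 !(addr0, add0r).
  by rewrite -scaler_nat !scalerA; congr (_ *: _); ring.
have [m0|m0] := eqVneq m 0; [by right | left].
have J (h : {scalar A}) : - 3 * m * (k * h f + l * h c) + 2 * m * l * h c + 2 * m * b * h c = 0.
  have := tp_jacobi t f c; rewrite bfc (tp_brC c t) btc btf.
  rewrite linearNr !linearDr !linearZr_LR /= !tp_brxx (tp_brC c t) (tp_brC c f) bfc btc.
  by move/(congr1 h); rewrite !scalarE => JJ; rewrite -[RHS]JJ; ring.
have k0 : k = 0.
  have := J q; rewrite q2 q3 !mulr0 !addr0 mulr1 => /eqP.
  by rewrite !mulf_eq0 oppr_eq0 pnatr_eq0 (negPf m0) => /eqP.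
have l0 : l = 2 * b.
  have := J r; rewrite r2 r3 k0 => H; apply/eqP; rewrite -subr_eq0.
  by rewrite -(mulIr_eq0 _ (mulIf m0)) -oppr_eq0 -H; apply/eqP; ring.
by rewrite btc k0 l0 scale0r add0r.
Qed.

(** Gram--Schmidt for the product: c = x^2 annihilates A, the vanishing of x (x f) forces x f to be
    a multiple of c, and subtracting a multiple of x makes f orthogonal to x. Triple products
    vanish, so the square of the new f is also a multiple of c. *)
Lemma realization_square_neq0 x : (forall x y z, x ** y ** z = 0) -> x ** x != 0 ->
  has_novikov_poisson_realization A.
Proof.
move=> mul3; set c := x ** x => c0.
have mc (u : A) : u ** c = 0 by rewrite /c tp_mulA mul3.
have mul3' (u v w : A) : u ** (v ** w) = 0 by rewrite tp_mulA mul3.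
have xc2 : free [:: x; c].
  apply: free2P => a b rel.
  have a0 : a = 0.
    apply: (scaler_eq0_scalar c0); have := congr1 (fun u => x ** u) rel.
    by rewrite linear0r !linearDr !linearZr_LR /= mc scaler0 addr0.
  move: rel; rewrite a0 scale0r add0r => rel.
  by split=> //; apply: (scaler_eq0_scalar c0).
have [f fr] := free_extend3 dimA xc2.
have [p [q [r F]]] := free_frame dimA fr.
have [E [p1 q1 r1] [p2 q2 r2] [p3 q3 r3]] := F.
have sqr0 (k : K) : k * k = 0 -> k = 0 by move/eqP; rewrite mulf_eq0 orbb => /eqP.
have xfE := E (x ** f).
set a := p _ in xfE; set b := q _ in xfE; set d := r _ in xfE.
have H : a *: c + d *: (x ** f) = 0.
  have := mul3' x x f; rewrite {1}xfE !linearDr !linearZr_LR /= mc scaler0 addr0.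
  by [].
have d0 : d = 0.
  by apply: sqr0; have := congr1 r H; rewrite !scalarE r2 mulr0 add0r.
have a0 : a = 0.
  by move: H; rewrite d0 scale0r addr0 => /(scaler_eq0_scalar c0).
move: xfE; rewrite a0 d0 !scale0r add0r addr0 => xfE.
pose f' := f - b *: x.
have xf' : x ** f' = 0 by rewrite /f' linearBr linearZr_LR /= xfE subrr.
have fr' : free [:: x; f'; c].
  apply: (frame_free3 (d := -1) F); last by rewrite oppr_eq0 oner_neq0.
  by rewrite /f' !scalarE p1 p2 p3 q1 q2 q3 r1 r2 r3; ring.
have [p' [q' [r' F']]] := free_frame dimA fr'.
have [E' [p1' q1' r1'] [p2' q2' r2'] [p3' q3' r3']] := F'.
have ffE := E' (f' ** f'); clearbody f'.
set a' := p' _ in ffE; set b' := q' _ in ffE; set g := r' _ in ffE.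
have a0' : a' = 0.
  apply: (scaler_eq0_scalar c0); have := mul3' x f' f'.
  by rewrite ffE !linearDr !linearZr_LR /= mc xf' !scaler0 !addr0.
have b0' : b' = 0.
  apply: sqr0; have := congr1 q' (mul3' f' f' f').
  rewrite {1}ffE !linearDr !linearZr_LR /= mc (tp_mulC f' x) xf' !scaler0 addr0 add0r.
  by rewrite !scalarE.
apply: (realization_metric fr' (g := g)) => //.
by rewrite ffE a0' b0' !scale0r !add0r.
Qed.

Lemma realization_mul0 : (forall x y, x ** y = 0) -> ~ tp_isomorphic A (P19 K) ->
  has_novikov_poisson_realization A.
Proof.
move=> mul0 niso; case: (lie3_dichotomy dimA) => [|/(isomorphic_P19 dimA mul0)//].
case=> e1 [e2 [e3 [p [q [r [F b23 pb12 pb13]]]]]].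
by apply: (realization_abelian_frame F) => // x y; rewrite mul0 scalarE.
Qed.

Lemma realization_of_not_isomorphic : ~ tp_isomorphic A (P19 K) ->
  has_novikov_poisson_realization A.
Proof.
move=> niso.
have [[e [e0 ee]]|noidem] := pselect (exists e : A, e != 0 /\ e ** e = e).
  exact: (realization_of_idempotent dimA e0 ee).
have nil x : x ** x ** (x ** x) = 0.
  have [//|[g [g0 gg _]]] := nilpotent_or_idempotent dimA x.
  by case: noidem; exists g.
have [cube|/existsNP[x /eqP x3]] := pselect (forall x, x ** x ** x = 0); last first.
  exact: (realization_cube_neq0 x3 (nil x)).
have mul3 := mul3_eq0 cube.
have [sq|/existsNP[x /eqP x2]] := pselect (forall x, x ** x = 0); last first.
  exact: (realization_square_neq0 mul3 x2).
apply: realization_mul0 => // x y; apply: (@mulr2I _ A); rewrite mul0rn.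
have := sq (x + y); rewrite linearDl !linearDr !sq (tp_mulC y x) /=.
by rewrite add0r addr0 mulr2n.
Qed.

End Nilpotent.

(** * The equivalence over the complex numbers *)

Local Open Scope complex_scope.

Theorem theorem3p5 (R : realType) (A : tpAlgebra R[i]) (dimA : \dim {:A} = 3%N) :
  has_novikov_poisson_realization A <-> ~ tp_isomorphic A (P19 R[i]).
Proof.
split=> [real iso|]; last exact: realization_of_not_isomorphic.
exact: (sl2_basis_no_realization dimA (sl2_basis_of_isomorphic iso) real).
Qed.
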